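(* Let $m\ge 2$ and $N\ge 0$ be integers, let $c_0,\ldots,c_N\in\mathbb{C}$ with $c_N\neq 0$, and put $h_n=c_n\sqrt{n!/m^n}$ for $0\le n\le N$. Let $|\Psi\rangle=\sum_{n=0}^N c_n|\Psi_n\rangle$ (the output of a balanced $m$-port beam-splitter with input $\sum_{n=0}^N c_n|n\rangle\otimes|0,\ldots,0\rangle$) and $|\Phi\rangle=\sum_{n=0}^N h_n|\Phi_n\rangle$. Then $|\Phi\rangle$ is SLOCC-equivalent to $|\Phi_N\rangle$. Moreover, writing $\sim$ for SLOCC-equivalence, $$|\Psi\rangle\sim|\Phi\rangle\sim|\Phi_N\rangle\sim|\Psi_N\rangle.$$
   Context: The state space is $\mathcal{H}=\mathcal{H}_1\otimes\cdots\otimes\mathcal{H}_m$, where each mode space $\mathcal{H}_k$ is a copy of the Fock space with orthonormal number basis $|0\rangle,|1\rangle,|2\rangle,\ldots$; write $|n_1\ldots n_m\rangle=|n_1\rangle\otimes\cdots\otimes|n_m\rangle$. Two (possibly unnormalized) vectors $|\Psi\rangle,|\Phi\rangle\in\mathcal{H}$ are SLOCC-equivalent if there are invertible operators $A_k$ on $\mathcal{H}_k$ (bounded with bounded inverse), $k=1,\ldots,m$, with $|\Phi\rangle=A_1\otimes\cdots\otimes A_m|\Psi\rangle$. For $n\ge 0$ define $$|\Psi_n\rangle=\frac{1}{m^{n/2}}\sum_{n_1+\cdots+n_m=n}\sqrt{\binom{n}{n_1,\ldots,n_m}}\,|n_1\ldots n_m\rangle,\qquad |\Phi_n\rangle=\sum_{n_1+\cdots+n_m=n}|n_1\ldots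 n_m\rangle,$$ where the sums run over all tuples of non-negative integers with sum $n$ and $\binom{n}{n_1,\ldots,n_m}=\frac{n!}{n_1!\cdots n_m!}$. The state $|\Psi_n\rangle$ is the image of $|n,0,\ldots,0\rangle$ under the unitary $U_S$ of a balanced $m$-port beam-splitter, which fixes the vacuum and satisfies $U_Sa_1^\dagger U_S^\dagger=(a_1^\dagger+\cdots+a_m^\dagger)/\sqrt m$, where $a_k^\dagger$ is the creation operator of mode $k$. *)

(* Defs.v *)
From HB Require Import structures.
From mathcomp Require Import all_boot all_order all_algebra.
From mathcomp Require Import finmap.
From mathcomp Require Import mathcomp_extra boolp classical_sets functions.
From mathcomp Require Import cardinality fsbigop reals ereal esum.
From mathcomp Require Import complex.
From mathcomp Require Import ring lra.

Set Implicit Arguments.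
Unset Strict Implicit.
Unset Printing Implicit Defensive.

Import Order.TTheory GRing.Theory Num.Theory.
Local Open Scope classical_set_scope.
Local Open Scope ring_scope.
Local Open Scope complex_scope.

Section SqNorm.
Context (R : realType) (I : choiceType).

(* Squared l^2 norm, possibly infinite. *)
Definition sqnorm (x : I -> R[i]) : \bar R :=
  \esum_(i in [set: I]) (Normc.normc (x i) ^+ 2)%:E.

Definition square_summable : {pred I -> R[i]} :=
  [pred x | `[< (sqnorm x < +oo)%E >]].

Lemma normc_sqrE (z : R[i]) : Normc.normc z ^+ 2 = complex.Re z ^+ 2 + complex.Im z ^+ 2.
Proof. by case: z => a b /=; rewrite sqr_sqrtr ?addr_ge0 ?sqr_ge0. Qed.

Lemma sqnorm0 : sqnorm 0 = 0%E.
Proof. by apply: esum1 => i _; rewrite Normc.normc0 expr0n. Qed.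

Lemma sqnorm_lin (a : R[i]) (x y : I -> R[i]) :
  (sqnorm (a *: x + y)%R <=
     (2 * Normc.normc a ^+ 2)%:E * sqnorm x + 2%:E * sqnorm y)%E.
Proof.
apply: ge_ereal_sup => _ [F [finF _] <-].
have le1 (z : I -> R[i]) :
    (\sum_(i \in F) (Normc.normc (z i) ^+ 2)%:E <= sqnorm z)%E.
  by apply: ereal_sup_ubound; exists F.
apply: (@le_trans _ _ (\sum_(i \in F)
    ((2 * Normc.normc a ^+ 2)%:E * (Normc.normc (x i) ^+ 2)%:E +
     2%:E * (Normc.normc (y i) ^+ 2)%:E))%E).
  apply: lee_fsum => // i _; rewrite -!EFinM -EFinD lee_fin.
  have -> : (a *: x + y) i = a * x i + y i by [].
  rewrite -mulrA -exprMn -Normc.normcM -mulrDr.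
  move: (a * x i) (y i) => [p q] [r s].
  rewrite !normc_sqrE /= -subr_ge0.
  have -> : 2 * (p ^+ 2 + q ^+ 2 + (r ^+ 2 + s ^+ 2)) -
    ((p + r) ^+ 2 + (q + s) ^+ 2) = (p - r) ^+ 2 + (q - s) ^+ 2 :> R.
    by ring.
  by rewrite addr_ge0 ?sqr_ge0.
have le2 (c : R) (z : I -> R[i]) : 0 <= c ->
    (\sum_(i \in F) c%:E * (Normc.normc (z i) ^+ 2)%:E <= c%:E * sqnorm z)%E.
  move=> c0; rewrite -ge0_mule_fsumr => [|i]; last by rewrite lee_fin sqr_ge0.
  by apply: lee_wpmul2l; [rewrite lee_fin|exact: le1].
rewrite fsbig_split//=; apply: leeD; apply: le2.
  by rewrite mulr_ge0// sqr_ge0.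
by [].
Qed.

Lemma sqnorm_ge0 (x : I -> R[i]) : (0 <= sqnorm x)%E.
Proof. by apply: esum_ge0 => i _; rewrite lee_fin sqr_ge0. Qed.

Lemma square_summable_submod : submod_closed square_summable.
Proof.
split=> [|a x y]; rewrite !inE; first by rewrite sqnorm0 ltry.
move=> xfin yfin.
apply: le_lt_trans (sqnorm_lin a x y) _.
have xf : sqnorm x \is a fin_num by rewrite ge0_fin_numE ?sqnorm_ge0.
have yf : sqnorm y \is a fin_num by rewrite ge0_fin_numE ?sqnorm_ge0.
by rewrite -(fineK xf) -(fineK yf) -!EFinM -EFinD ltry.
Qed.

HB.instance Definition _ :=
  GRing.isSubmodClosed.Build R[i] (I -> R[i]) square_summable
    square_summable_submod.

End SqNorm.

(* The complex Hilbert space l^2(I), as the subspace of I -> R[i] of square-summable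
   families. *)
Section Ell2.
Context (R : realType) (I : choiceType).

Record ell2 : Type := Ell2 {
  ell2_val :> I -> R[i];
  ell2P : ell2_val \in @square_summable R I }.

HB.instance Definition _ := [isSub for ell2_val].
HB.instance Definition _ := [Choice of ell2 by <:].
HB.instance Definition _ := [SubChoice_isSubLmodule of ell2 by <:].

Definition ell2_norm (x : ell2) : R := Num.sqrt (fine (sqnorm x)).

Lemma basis_vec_square_summable (j : I) :
  (fun i => (i == j)%:R : R[i]) \in @square_summable R I.
Proof.
rewrite inE /sqnorm (esum_mkcond _ _) /=.
rewrite (_ : (\esum_(_ in _) _)%E =
  (\esum_(i in [set j]) 1%:E)%E :> \bar R); first by rewrite esum_set1// ltry.
rewrite [RHS]esum_mkcond; apply: eq_esum => i _; rewrite in_setT.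
have [->|ij] := eqVneq i j.
  by rewrite mem_set// Normc.normc1 expr1n.
rewrite memNset ?Normc.normc0 ?expr0n//= => /eqP; exact/negP.
Qed.

(* The canonical orthonormal basis of l^2(I). *)
Definition basis_vec (j : I) : ell2 := Ell2 (basis_vec_square_summable j).

Definition bounded_op (A : ell2 -> ell2) : Prop :=
  exists M : R, forall x : ell2, ell2_norm (A x) <= M * ell2_norm x.

Definition bounded_invertible (A : {linear ell2 -> ell2}) : Prop :=
  bounded_op A /\
  exists B : {linear ell2 -> ell2}, [/\ bounded_op B, cancel A B & cancel B A].

End Ell2.

Section Modes.
Context (R : realType) (m : nat).

(* Fock space in number-basis coordinates: |j> is [basis_vec R j]. *)
Definition fock := ell2 R nat.

(* The m-fold Hilbert tensor power of [fock], realised as l^2(nat^m):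
   |n_1 ... n_m> is the basis vector at (n_1, ..., n_m). *)
Definition modes := ell2 R {ffun 'I_m -> nat}.

Lemma tensor_square_summable (v : 'I_m -> fock) :
  (fun n : {ffun 'I_m -> nat} => \prod_k v k (n k)) \in
  @square_summable R {ffun 'I_m -> nat}.
Proof.
rewrite inE.
pose a k j : R := Normc.normc (v k j) ^+ 2.
have a0 k j : 0 <= a k j by exact: sqr_ge0.
have vfin k : (sqnorm (v k) < +oo)%E.
  by have := ell2P (v k); rewrite inE.
pose S k : R := fine (sqnorm (v k)).
have leS k K : \sum_(j < K) a k j <= S k.
  rewrite -lee_fin fineK ?ge0_fin_numE ?sqnorm_ge0//.
  rewrite -sumEFin (fsbig_ord _ _ (fun j => (a k j)%:E)).
  by apply: ereal_sup_ubound; exists `I_K.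
apply: (@le_lt_trans _ _ ((\prod_k S k)%:E : \bar R)); last by rewrite ltry.
apply: ge_ereal_sup => _ [F [finF _] <-].
rewrite fsbig_finite//= sumEFin lee_fin.
set s := enum_fset _.
have [K KP] : exists K, forall p, p \in s -> forall k, (p k < K.+1)%N.
  exists (\max_(p <- s) \max_k p k)%N => p ps k.
  rewrite ltnS (leq_trans (leq_bigmax k))//.
  exact: (@leq_bigmax_seq _ _ _ (fun q : {ffun 'I_m -> nat} => \max_k q k)%N).
pose g (p : {ffun 'I_m -> nat}) : {ffun 'I_m -> 'I_K.+1} :=
  [ffun k => inord (p k)].
have gK p k : p \in s -> g p k = p k :> nat.
  by move=> ps; rewrite ffunE inordK// KP.
rewrite (_ : \sum_(p <- s) _ = \sum_(p <- s) \prod_k a k (g p k)); last first.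
  apply: eq_big_seq => p ps.
  rewrite (big_morph _ (@Normc.normcM R) (@Normc.normc1 R)) -prodrXl.
  by apply: eq_bigr => k _; rewrite gK.
rewrite -(big_map g predT (fun q : {ffun 'I_m -> 'I_K.+1} =>
  \prod_k a k (q k))) big_uniq/=; last first.
  rewrite map_inj_in_uniq ?fset_uniq// => p q ps qs pq.
  by apply/ffunP => k; rewrite -gK// -[RHS]gK// pq.
rewrite big_mkcond/=.
apply: (@le_trans _ _ (\sum_(q : {ffun 'I_m -> 'I_K.+1}) \prod_k a k (q k))).
  by apply: ler_sum => q _; case: ifP => // _; apply: prodr_ge0.
rewrite -(bigA_distr_bigA (fun k (j : 'I_K.+1) => a k j)).
by apply: ler_prod => k _; rewrite leS sumr_ge0.
Qed.

Definition tensor (v : 'I_m -> fock) : modes :=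
  Ell2 (tensor_square_summable v).

(* The product vectors [tensor v] span a dense subspace, so a bounded T with
   this property is unique: it is A_0 (x) ... (x) A_(m-1). *)
Definition is_tensor_op (A : 'I_m -> {linear fock -> fock})
    (T : {linear modes -> modes}) : Prop :=
  bounded_op T /\
  forall v : 'I_m -> fock, T (tensor v) = tensor (fun k => A k (v k)).

Definition slocc_equiv (Psi Phi : modes) : Prop :=
  exists (A : 'I_m -> {linear fock -> fock}) (T : {linear modes -> modes}),
    [/\ forall k, bounded_invertible (A k), is_tensor_op A T & Phi = T Psi].

Definition ket (p : 'I_m -> nat) : modes := tensor (fun k => basis_vec R (p k)).

Definition multinomial (n : nat) (p : 'I_m -> nat) : R[i] :=
  n`!%:R / \prod_k (p k)`!%:R.

(* Each part of a tuple of sum n is at most n, so it is harmless to let the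
   tuples range over the finite type of functions 'I_m -> 'I_n.+1. *)
Definition Psi_state (n : nat) : modes :=
  (sqrtC m%:R ^+ n)^-1 *:
  \sum_(p : {ffun 'I_m -> 'I_n.+1} | (\sum_k p k == n)%N)
     sqrtC (multinomial n (fun k => p k)) *: ket (fun k => p k).

Definition Phi_state (n : nat) : modes :=
  \sum_(p : {ffun 'I_m -> 'I_n.+1} | (\sum_k p k == n)%N) ket (fun k => p k).

End Modes.

(* Main.v *)
Require Import Defs.
From HB Require Import structures.
From mathcomp Require Import all_boot all_order all_algebra.
From mathcomp Require Import boolp classical_sets functions cardinality fsbigop.
From mathcomp Require Import reals ereal esum complex.
From mathcomp Require Import zify ring.

Set Implicit Arguments.
Unset Strict Implicit.
Unset Printing Implicit Defensive.

Import Order.TTheory GRing.Theory Num.Theory.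
Local Open Scope ring_scope.
Local Open Scope complex_scope.

(* The amplitudes of Phi and Psi at (n_1, ..., n_m) with sum n <= N differ by the
   factor \prod_k sqrt(n_k!), so the diagonal operators |j> |-> sqrt(min(j, N)!) |j>
   carry one to the other; the same holds for Phi_N and Psi_N up to a scalar.
   For Phi ~ Phi_N a single mode suffices. Let S be the backward shift
   |j> |-> |j - 1> of that mode for 1 <= j <= N, and 0 on |0> and on all |j>, j > N.
   Then S^k Phi_N = Phi_(N-k), hence Phi = u(S) Phi_N with
   u = \sum_k h_(N-k) X^k. As S^(N+1) = 0 and u(0) = h_N <> 0, an inverse of u
   modulo X^(N+1) gives a bounded inverse of u(S). *)

(** * Polynomials in a linear operator, and inverses modulo [X^n] *)

Section PolyOp.
Context (K : comNzRingType) (V : lmodType K) (S : {linear V -> V}).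

Definition poly_op (p : {poly K}) (x : V) : V :=
  \sum_(k < size p) p`_k *: iter k S x.

Lemma iter_is_linear k : linear (iter k S).
Proof. by elim: k => // k IH a x y; rewrite !iterS IH linearP. Qed.

Lemma poly_op_is_linear p : linear (poly_op p).
Proof.
move=> a x y; rewrite /poly_op scaler_sumr -big_split; apply: eq_bigr => k _ /=.
by rewrite iter_is_linear scalerDr !scalerA mulrC.
Qed.

HB.instance Definition _ p :=
  GRing.isLinear.Build K V V *:%R (poly_op p) (poly_op_is_linear p).

(** Padding with zero coefficients gives polynomials of different sizes a common summation range. *)
Lemma poly_op_wide n (p : {poly K}) x : (size p <= n)%N ->
  poly_op p x = \sum_(k < n) p`_k *: iter k S x.
Proof.
move=> pn; rewrite /poly_op (big_ord_widen_cond _ xpredT (fun k => p`_k *: iter k S x) pn).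
rewrite big_mkcond; apply: eq_bigr => k _; case: ltnP => // kp.
by rewrite nth_default// scale0r.
Qed.

Lemma poly_opD p q x : poly_op (p + q) x = poly_op p x + poly_op q x.
Proof.
rewrite !(@poly_op_wide (maxn (size p) (size q))) ?leq_maxl ?leq_maxr ?size_polyD//.
by rewrite -big_split; apply: eq_bigr => k _; rewrite coefD scalerDl.
Qed.

Lemma poly_opC c x : poly_op c%:P x = c *: x.
Proof. by rewrite (@poly_op_wide 1) ?size_polyC_leq1// big_ord1 coefC. Qed.

Lemma poly_opMX p x : poly_op (p * 'X) x = S (poly_op p x).
Proof.
rewrite (@poly_op_wide (size p).+1); last first.
  by rewrite (leq_trans (size_polyMleq _ _))// size_polyX addn2.
rewrite big_ord_recl coefMX scale0r add0r linear_sum; apply: eq_bigr => k _.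
by rewrite coefMX linearZ.
Qed.

Lemma poly_op_scale c p x : poly_op (c%:P * p) x = c *: poly_op p x.
Proof.
rewrite (@poly_op_wide (size p)); last first.
  by rewrite mul_polyC size_scale_leq.
by rewrite scaler_sumr; apply: eq_bigr => k _; rewrite coefCM scalerA.
Qed.

(** Horner induction on [p]. Multiplicativity is what turns identities between polynomials into
    identities between operators. *)
Lemma poly_opM p q x : poly_op (p * q) x = poly_op p (poly_op q x).
Proof.
elim/poly_ind: p => [|p c IH].
  by rewrite mul0r -!(polyC0 K) !poly_opC !scale0r.
rewrite mulrDl !poly_opD mulrAC !poly_opMX IH.
by rewrite poly_op_scale poly_opC.
Qed.

Lemma poly_opXn n x : poly_op 'X^n x = iter n S x.
Proof.
elim: n => [|n IH]; first by rewrite expr0 poly_opC scale1r.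
by rewrite exprSr poly_opMX IH.
Qed.

End PolyOp.

(** Since 0 is not a root, [u] is coprime to [X], hence to [X^n]; Bezout gives [v]. *)
Lemma unit_mod_Xn (K : fieldType) (u : {poly K}) n : u`_0 != 0 ->
  exists v w : {poly K}, v * u = 1 + w * 'X^n.
Proof.
move=> u0; have /Bezout_eq1_coprimepP [[v w] /= vw] : coprimep u 'X^n.
  by apply: coprimep_expr; rewrite coprimepX rootE horner_coef0.
by exists v, (- w); rewrite -vw mulNr addrK.
Qed.

Lemma normc_ge0 (R : rcfType) (z : R[i]) : 0 <= Normc.normc z.
Proof. by case: z => a b; exact: sqrtr_ge0. Qed.

(** * Bounded operators on l^2 *)

Section Bounded.
Context (R : realType) (I : choiceType).
Implicit Types (x y : ell2 R I).

Lemma ell2_norm_sqr x : (ell2_norm x ^+ 2)%:E = sqnorm x.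
Proof.
rewrite /ell2_norm sqr_sqrtr ?fineK ?fine_ge0 ?sqnorm_ge0//.
by rewrite ge0_fin_numE ?sqnorm_ge0//; have := ell2P x; rewrite inE.
Qed.

(** Squared norms are suprema of finite partial sums, so bounds are easier to prove in this form. *)
Lemma bounded_opP (A : ell2 R I -> ell2 R I) :
  bounded_op A <-> exists2 M : R, 0 <= M &
    forall x, (sqnorm (A x) <= M%:E * sqnorm x)%E.
Proof.
split=> [[M AM]|[M M0 AM]].
  exists (M ^+ 2); rewrite ?sqr_ge0// => x.
  rewrite -!ell2_norm_sqr -EFinM lee_fin -exprMn.
  (* [M] comes without a sign, but [M * ell2_norm x] is nonnegative because it dominates a norm. *)
  by rewrite ler_pXn2r ?AM// nnegrE ?sqrtr_ge0// (le_trans _ (AM x)) ?sqrtr_ge0.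
exists (Num.sqrt M) => x.
rewrite -(@ler_pXn2r _ 2) ?nnegrE ?mulr_ge0 ?sqrtr_ge0//.
by rewrite exprMn -lee_fin (EFinM (Num.sqrt M ^+ 2)) !ell2_norm_sqr sqr_sqrtr.
Qed.

Lemma bounded_op_lin a (A B : ell2 R I -> ell2 R I) :
  bounded_op A -> bounded_op B -> bounded_op (fun x => a *: A x + B x).
Proof.
move=> /bounded_opP[M M0 AM] /bounded_opP[M' M'0 BM]; apply/bounded_opP.
exists (2 * Normc.normc a ^+ 2 * M + 2 * M').
  by apply: addr_ge0; rewrite mulr_ge0// mulr_ge0// sqr_ge0.
move=> x; apply: le_trans (sqnorm_lin a (A x) (B x)) _.
have a0 : 0 <= 2 * Normc.normc a ^+ 2 by rewrite mulr_ge0 ?sqr_ge0.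
have aM0 : 0 <= 2 * Normc.normc a ^+ 2 * M by exact: mulr_ge0.
have M20 : 0 <= 2 * M' by exact: mulr_ge0.
rewrite (EFinD (_ * M)) [leRHS]ge0_muleDl ?lee_fin//.
rewrite (EFinM (2 * _) M) (EFinM 2 M') -!muleA; apply: leeD.
  by apply: lee_wpmul2l; rewrite ?lee_fin.
by apply: lee_wpmul2l; rewrite ?lee_fin.
Qed.

Lemma bounded_op_comp (A B : ell2 R I -> ell2 R I) :
  bounded_op A -> bounded_op B -> bounded_op (A \o B).
Proof.
move=> /bounded_opP[M M0 AM] /bounded_opP[M' M'0 BM]; apply/bounded_opP.
exists (M * M') => [|x /=]; first exact: mulr_ge0.
by apply: le_trans (AM _) _; rewrite EFinM -muleA; exact: lee_wpmul2l.
Qed.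

Lemma bounded_op_id : bounded_op (@id (ell2 R I)).
Proof. by exists 1 => x; rewrite mul1r. Qed.

Lemma bounded_op_iter k (A : ell2 R I -> ell2 R I) :
  bounded_op A -> bounded_op (iter k A).
Proof.
move=> bA; elim: k => [|k]; first exact: bounded_op_id.
exact: bounded_op_comp.
Qed.

Lemma bounded_op_poly (S : {linear ell2 R I -> ell2 R I}) p :
  bounded_op S -> bounded_op (poly_op S p).
Proof.
move=> bS; rewrite /poly_op.
have : bounded_op (fun _ : ell2 R I => 0 : ell2 R I).
  by exists 0 => x; rewrite /ell2_norm sqnorm0 sqrtr0 mul0r.
elim: (size p) => [|n IH] b0.
  rewrite (_ : (fun x => _) = fun _ => 0)//.
  by apply/funext => x; rewrite big_ord0.
rewrite (_ : (fun x => _) = fun x => p`_n *: iter n S x +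
    \sum_(k < n) p`_k *: iter k S x); last first.
  by apply/funext => x; rewrite big_ord_recr addrC.
by apply: bounded_op_lin (IH b0); apply: bounded_op_iter.
Qed.

(** * Weighted pullbacks along an injection *)

Definition bounded_weight (w : I -> R[i]) := exists M, forall i, Normc.normc (w i) <= M.

Section Wpull.
Context (w : I -> R[i]) (f : I -> I).
Hypotheses (w_bnd : bounded_weight w) (f_inj : injective f).

(** As [f] is injective, summing [|x (f i)|^2] over a finite [F] is summing [|x j|^2] over the image
    of [F], a partial sum of [sqnorm x]. *)
Lemma sqnorm_wpull : exists2 M : R, 0 <= M &
  forall x : I -> R[i], (sqnorm (fun i => w i * x (f i))%R <= M%:E * sqnorm x)%E.
Proof.
have [M wM] := w_bnd; exists (M ^+ 2); rewrite ?sqr_ge0// => x.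
apply: ge_ereal_sup => _ [F [finF _] <-].
apply: (@le_trans _ _ (\sum_(i \in F) (M ^+ 2)%:E * (Normc.normc (x (f i)) ^+ 2)%:E)%E).
  apply: lee_fsum => // i _; rewrite -EFinM lee_fin Normc.normcM exprMn.
  rewrite ler_wpM2r ?sqr_ge0// ler_pXn2r ?nnegrE ?normc_ge0//.
  exact: le_trans (normc_ge0 _) (wM i).
rewrite -ge0_mule_fsumr; last by move=> i; rewrite lee_fin sqr_ge0.
apply: lee_wpmul2l; first by rewrite lee_fin sqr_ge0.
rewrite -(@fsbig_image _ _ _ _ _ F f (fun j => (Normc.normc (x j) ^+ 2)%:E)); last first.
  by move=> i j _ _; exact: f_inj.
by apply: ereal_sup_ubound; exists (f @` F)%classic => //; split=> //; exact: finite_image.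
Qed.

Lemma wpull_square_summable x : (fun i => w i * x (f i)) \in @square_summable R I.
Proof.
have [M _ wM] := sqnorm_wpull; rewrite inE.
by apply: le_lt_trans (wM x) _; rewrite -ell2_norm_sqr -EFinM ltry.
Qed.

(** A common form for the truncated shifts and, with [f] the identity, the diagonal operators. *)
Definition wpull x : ell2 R I := Ell2 (wpull_square_summable x).

Lemma wpull_is_linear : linear wpull.
Proof.
move=> a x y; apply: val_inj; apply/funext => i.
have scaleE : w i * (a * x (f i) + y (f i)) = a * (w i * x (f i)) + w i * y (f i).
  by ring.
exact: scaleE.
Qed.

HB.instance Definition _ :=
  GRing.isLinear.Build R[i] (ell2 R I) (ell2 R I) *:%R wpull wpull_is_linear.

Lemma bounded_op_wpull : bounded_op wpull.
Proof. by have [M M0 wM] := sqnorm_wpull; apply/bounded_opP; exists M => // x; exact: wM. Qed.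

End Wpull.
End Bounded.

(** * Nilpotent truncated shifts *)

Section TruncatedShift.
Context (R : realType) (I : choiceType) (f : I -> I) (ht : I -> nat) (N : nat).
Hypotheses (f_inj : injective f) (ht_f : forall i, ht (f i) = (ht i).+1).

Lemma bounded_weight_ltn : bounded_weight (fun i => (ht i < N)%:R : R[i]).
Proof.
exists 1 => i; case: ltnP => _; first by rewrite Normc.normc1.
by rewrite Normc.normc0.
Qed.

(** On basis vectors: [f i] goes to [i] when [ht i < N], and all others go to 0. Both the shift on
    one Fock space and its extension to all modes are instances. *)
Definition tshift : {linear ell2 R I -> ell2 R I} :=
  wpull bounded_weight_ltn f_inj.

(** Each application tests that the height is below [N] and then raises it by one, so a nonzero
    coordinate after [k > 0] steps forces [ht i + k <= N]. *)
Lemma iter_tshift_eq0 k x i :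
  (0 < k)%N -> (N < ht i + k)%N -> iter k tshift x i = 0.
Proof.
elim: k i => // k IH i _ Nik; rewrite iterS.
rewrite (_ : tshift _ i = (ht i < N)%:R * iter k tshift x (f i))//.
case: ltnP => iN; last by rewrite mul0r.
by rewrite IH ?mulr0 ?ht_f//; lia.
Qed.

Lemma tshift_nilpotent x : iter N.+1 tshift x = 0.
Proof.
by apply: val_inj; apply/funext => i; apply: iter_tshift_eq0 => //; lia.
Qed.

Lemma poly_op_tshiftK (u v w : {poly R[i]}) : v * u = 1 + w * 'X^(N.+1) ->
  cancel (poly_op tshift u) (poly_op tshift v).
Proof.
move=> vu x; rewrite -poly_opM vu poly_opD poly_opM poly_opXn tshift_nilpotent.
by rewrite linear0 addr0 poly_opC scale1r.
Qed.

Lemma bounded_invertible_poly_tshift (u : {poly R[i]}) : u`_0 != 0 ->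
  bounded_invertible (poly_op tshift u).
Proof.
move=> /unit_mod_Xn -/(_ N.+1) [v [w vu]].
split; first exact/bounded_op_poly/bounded_op_wpull.
exists (poly_op tshift v); split; first exact/bounded_op_poly/bounded_op_wpull.
- exact: poly_op_tshiftK vu.
(* Polynomials commute, so the left inverse is also a right inverse. *)
- by apply: (@poly_op_tshiftK _ _ w); rewrite mulrC.
Qed.

End TruncatedShift.

(** * The shift of a single mode inside the tensor product *)

Section Slot.
Context (R : realType) (m N : nat) (i0 : 'I_m).

Definition fock_shift : {linear fock R -> fock R} := tshift R id N succn_inj.

Definition incr (p : {ffun 'I_m -> nat}) : {ffun 'I_m -> nat} :=
  [ffun k => (p k + (k == i0))%N].

Lemma incr_inj : injective incr.
Proof.
by move=> p q /ffunP pq; apply/ffunP => k; have := pq k; rewrite !ffunE => /addIn.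
Qed.

Definition slot_shift : {linear modes R m -> modes R m} :=
  tshift R (fun p : {ffun 'I_m -> nat} => p i0) N incr_inj.

Lemma slot_shiftE (x : modes R m) (p : {ffun 'I_m -> nat}) :
  slot_shift x p = (p i0 < N)%:R * x (incr p).
Proof. by []. Qed.

Definition upd (v : 'I_m -> fock R) (x : fock R) : 'I_m -> fock R :=
  fun k => if k == i0 then x else v k.

(** Freezing all factors but the one at [i0] turns the multilinear [tensor] into a linear map,
    through which polynomials in the shift can pass. *)
Definition tensor_upd v x : modes R m := tensor (upd v x).

Lemma tensor_updE v x (p : {ffun 'I_m -> nat}) :
  tensor_upd v x p = x (p i0) * \prod_(k | k != i0) v k (p k).
Proof.
rewrite (_ : tensor_upd v x p = \prod_k upd v x k (p k))// (bigD1 i0)//= /upd eqxx.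
by congr (_ * _); apply: eq_bigr => k /negbTE ->.
Qed.

Lemma upd_same v : upd v (v i0) = v.
Proof. by apply/funext => k; rewrite /upd; case: eqP => [->|]. Qed.

Lemma slot_shift_tensor v x :
  slot_shift (tensor_upd v x) = tensor_upd v (fock_shift x).
Proof.
apply: val_inj; apply/funext => p.
have : slot_shift (tensor_upd v x) p = tensor_upd v (fock_shift x) p; last by [].
rewrite slot_shiftE !tensor_updE mulrA !ffunE eqxx addn1; congr (_ * _).
by apply: eq_bigr => k /negbTE k0; rewrite ffunE k0 addn0.
Qed.

Lemma tensor_upd_is_linear v : linear (tensor_upd v).
Proof.
move=> a x y; apply: val_inj; apply/funext => p.
have : tensor_upd v (a *: x + y) p =
    a * tensor_upd v x p + tensor_upd v y p; last by [].
rewrite !tensor_updE mulrA -mulrDl; congr (_ * _).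
Qed.

HB.instance Definition _ v :=
  GRing.isLinear.Build R[i] (fock R) (modes R m) *:%R
    (tensor_upd v) (tensor_upd_is_linear v).

Lemma poly_slot_shift_tensor u v : poly_op slot_shift u (tensor v) =
  tensor_upd v (poly_op fock_shift u (v i0)).
Proof.
rewrite /poly_op [RHS](linear_sum (tensor_upd v)).
apply: eq_bigr => k _; rewrite [RHS](linearZ_LR (tensor_upd v)) /=.
congr (_ *: _); elim: (k : nat) => [|j IH]; first by rewrite /tensor_upd upd_same.
by rewrite !iterS IH slot_shift_tensor.
Qed.

(** The local operators are [u] of the Fock shift at [i0] and the identity at every other mode. *)
Lemma slocc_poly_slot_shift (u : {poly R[i]}) x : u`_0 != 0 ->
  slocc_equiv x (poly_op slot_shift u x).
Proof.
move=> u0.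
exists (fun k => if k == i0 then poly_op fock_shift u : {linear _ -> _} else idfun).
exists (poly_op slot_shift u); split=> // [k|].
  case: eqP => _; first exact: bounded_invertible_poly_tshift.
  by split; [exact: bounded_op_id|exists idfun; split=> //; exact: bounded_op_id].
split=> [|v]; first exact/bounded_op_poly/bounded_op_wpull.
rewrite [LHS]poly_slot_shift_tensor; congr tensor; apply/funext => k; rewrite /upd.
by case: eqP => [->|].
Qed.

Lemma slocc_poly_slot_shift_sym (u : {poly R[i]}) x : u`_0 != 0 ->
  slocc_equiv (poly_op slot_shift u x) x.
Proof.
move=> u0; have [v [w vu]] := unit_mod_Xn N.+1 u0.
have xE : poly_op slot_shift v (poly_op slot_shift u x) = x.
  by apply: poly_op_tshiftK vu x => p; rewrite ffunE eqxx addn1.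
rewrite -[X in slocc_equiv _ X]xE; apply: slocc_poly_slot_shift.
(* Comparing constant coefficients gives [v(0) u(0) = 1], so [v] again has a nonzero constant
   term. *)
have := congr1 (fun p : {poly R[i]} => p`_0) vu.
rewrite coefD coefMXn ltn0Sn addr0 coef1 eqxx coef0M => v0u0.
by apply/eqP => v0; move/eqP: v0u0; rewrite v0 mul0r eq_sym oner_eq0.
Qed.

End Slot.

(** * Diagonal local operators *)

Section Diagonal.
Context (R : realType) (m N : nat).

Lemma bounded_weight_minn (w : nat -> R[i]) :
  bounded_weight (fun j => w (minn j N)).
Proof.
(* Only [w 0], ..., [w N] occur, so the sum of their moduli is a bound. *)
exists (\sum_(i < N.+1) Normc.normc (w i)) => j.
rewrite (bigD1 (inord (minn j N)))//= inordK ?ltnS ?geq_minr// lerDl.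
by apply: sumr_ge0 => i _; exact: normc_ge0.
Qed.

Lemma bounded_weight_prod (w : 'I_m -> nat -> R[i]) :
  (forall k, bounded_weight (w k)) ->
  bounded_weight (fun p : {ffun 'I_m -> nat} => \prod_k w k (p k)).
Proof.
move=> /choice[M wM]; exists (\prod_k M k) => p.
rewrite (big_morph _ (@Normc.normcM R) (@Normc.normc1 R)).
by apply: ler_prod => k _; rewrite normc_ge0 wM.
Qed.

(* Freezing the weights beyond N makes the operator bounded, and likewise its inverse. *)
Definition fock_diag (w : nat -> R[i]) : {linear fock R -> fock R} :=
  wpull (bounded_weight_minn w) (@inj_id nat).

Definition modes_diag (w : 'I_m -> nat -> R[i]) : {linear modes R m -> modes R m} :=
  wpull (bounded_weight_prod (fun k => bounded_weight_minn (w k)))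
    (@inj_id {ffun 'I_m -> nat}).

Lemma fock_diagK (w w' : nat -> R[i]) : (forall j, w' j * w j = 1) ->
  cancel (fock_diag w) (fock_diag w').
Proof.
move=> ww x; apply: val_inj; apply/funext => j.
have : w' (minn j N) * (w (minn j N) * x j) = x j; last by [].
by rewrite mulrA ww mul1r.
Qed.

(** A weight that factors over the modes is the tensor product of diagonal operators; the reciprocal
    weights give their inverses. *)
Lemma slocc_diag (w : 'I_m -> nat -> R[i]) (x y : modes R m) :
  (forall k j, w k j != 0) ->
  (forall p : {ffun 'I_m -> nat}, y p = (\prod_k w k (minn (p k) N)) * x p) ->
  slocc_equiv x y.
Proof.
move=> w0 yE; exists (fun k => fock_diag (w k)), (modes_diag w); split.
- move=> k; split; first exact: bounded_op_wpull.
  exists (fock_diag (fun j => (w k j)^-1)); split; first exact: bounded_op_wpull.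
    by apply: fock_diagK => j; rewrite mulVf.
  by apply: fock_diagK => j; rewrite mulfV.
- split=> [|v]; first exact: bounded_op_wpull.
  apply: val_inj; apply/funext => p.
  have : \prod_k w k (minn (p k) N) * \prod_k v k (p k) =
     \prod_k (w k (minn (p k) N) * v k (p k)); last by [].
  by rewrite big_split.
- by apply: val_inj; apply/funext => p; rewrite [LHS]yE.
Qed.

End Diagonal.

(** * Coordinates of the states in the number basis *)

Section States.
Context (R : realType) (m : nat).
Implicit Types (p : {ffun 'I_m -> nat}).

Lemma modes_sumE (J : Type) (r : seq J) (P : pred J) (F : J -> modes R m) p :
  (\sum_(j <- r | P j) F j) p = \sum_(j <- r | P j) F j p.
Proof. by apply: (big_morph (fun x : modes R m => x p)). Qed.

Lemma ketE (q : 'I_m -> nat) p : ket R q p = [forall k, p k == q k]%:R.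
Proof.
rewrite (_ : ket R q p = \prod_k (p k == q k)%:R)//.
case: forallP => [pq|/forallP]; first by rewrite big1// => k _; rewrite pq.
by rewrite negb_forall => /existsP[k /negbTE pk]; rewrite (bigD1 k)//= pk mul0r.
Qed.

(** Only the tuple equal to [p] contributes; it lies in the index type because the parts of a tuple
    of sum [n] are at most [n]. *)
Lemma sum_ketE n (F : ('I_m -> nat) -> R[i]) p :
  (\sum_(q : {ffun 'I_m -> 'I_n.+1} | (\sum_k q k == n)%N)
     F (fun k => q k) *: ket R (fun k => q k)) p =
  (\sum_k p k == n)%:R * F p.
Proof.
rewrite modes_sumE.
transitivity (\sum_(q : {ffun 'I_m -> 'I_n.+1} | (\sum_k q k == n)%N)
    F (fun k => q k) * [forall k, p k == q k]%:R).
  by apply: eq_bigr => q _; rewrite -ketE.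
have [pn|pn] := eqVneq (\sum_k p k)%N n; last first.
  rewrite mul0r big1// => q /eqP qn; case: forallP => [pq|_]; last by rewrite mulr0.
  by case/eqP: pn; rewrite -qn; apply: eq_bigr => k _; exact/eqP.
have p_le k : (p k < n.+1)%N by rewrite ltnS -pn (bigD1 k)//= leq_addr.
pose q0 : {ffun 'I_m -> 'I_n.+1} := [ffun k => inord (p k)].
have q0E k : q0 k = p k :> nat by rewrite ffunE inordK.
rewrite (bigD1 q0)/=; last by under eq_bigr do rewrite q0E; rewrite pn.
rewrite big1 => [|q /andP[_ qq0]]; last first.
  case: forallP => [pq|_]; last by rewrite mulr0.
  case/eqP: qq0; apply/ffunP => k; apply: val_inj.
  by rewrite /= q0E; apply/esym/eqP.
rewrite (_ : [forall k, _] = true) ?mulr1 ?mul1r ?addr0; last first.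
  by apply/forallP => k; rewrite q0E.
by congr F; apply/funext => k; rewrite q0E.
Qed.

Lemma Phi_stateE n p : Phi_state R m n p = (\sum_k p k == n)%:R.
Proof.
rewrite -[RHS]mulr1 -(sum_ketE n (fun=> 1)) /Phi_state.
by under [in RHS]eq_bigr do rewrite scale1r.
Qed.

Lemma sqrtC_multinomial n (p : 'I_m -> nat) :
  sqrtC (multinomial R n p) = sqrtC n`!%:R / \prod_k sqrtC (p k)`!%:R.
Proof.
have [prod_ge0 sqrt_prod] : 0 <= \prod_k (p k)`!%:R :> R[i] /\
    sqrtC (\prod_k (p k)`!%:R) = \prod_k sqrtC (p k)`!%:R :> R[i].
  (* Nonnegativity is carried along because the root of an inverse requires it. *)
  apply: (big_rec2 (fun x y : R[i] => 0 <= x /\ sqrtC x = y)) => [|k x y _ [x0 <-]].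
    by rewrite ler01 sqrtC1.
  by rewrite mulr_ge0// rootCMl.
by rewrite /multinomial rootCMl// rootCV// sqrt_prod.
Qed.

(** The amplitude splits into a scalar depending on [n] alone and a product over the modes, which
    diagonal operators can cancel. *)
Lemma Psi_stateE n p : Psi_state R m n p =
  (\sum_k p k == n)%:R *
  (sqrtC n`!%:R / sqrtC m%:R ^+ n / \prod_k sqrtC (p k)`!%:R).
Proof.
transitivity ((sqrtC m%:R ^+ n)^-1 * ((\sum_k p k == n)%:R * sqrtC (multinomial R n p))).
  by rewrite -(sum_ketE n (fun q => sqrtC (multinomial R n q))).
rewrite sqrtC_multinomial; ring.
Qed.

Lemma iter_slot_shift_Phi N (i0 : 'I_m) k : (k <= N)%N ->
  iter k (slot_shift R N i0) (Phi_state R m N) = Phi_state R m (N - k).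
Proof.
elim: k => [|k IH] kN; first by rewrite subn0.
rewrite iterS IH 1?ltnW//; apply: val_inj; apply/funext => p.
have : slot_shift R N i0 (Phi_state R m (N - k)) p = Phi_state R m (N - k.+1) p; last by [].
rewrite slot_shiftE !Phi_stateE -natrM mulnb; congr (nat_of_bool _)%:R.
have -> : (\sum_j incr i0 p j = (\sum_j p j).+1)%N.
  under eq_bigr do rewrite ffunE.
  by rewrite big_split/= -big_mkcond/= big_pred1_eq addn1.
(* The truncation loses nothing here: a tuple of sum [N - k.+1], where [k < N], has its part at [i0]
   below [N]. *)
have : (p i0 <= \sum_j p j)%N by rewrite (bigD1 i0)//= leq_addr.
move: (p i0) (\sum_j p j)%N => a s; do 2!case: eqP => ?; lia.
Qed.

(** The coefficients are reversed because [k] shifts lower the total from [N] to [N - k]; the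
    constant term is thus the top coefficient of [h]. *)
Lemma sum_Phi_state_slot_shift N (i0 : 'I_m) (h : 'I_N.+1 -> R[i]) :
  \sum_(n < N.+1) h n *: Phi_state R m n =
  poly_op (slot_shift R N i0) (\poly_(k < N.+1) h (inord (N - k))) (Phi_state R m N).
Proof.
rewrite (poly_op_wide _ _ (size_poly _ _)) (reindex_inj rev_ord_inj).
apply: eq_bigr => k _; rewrite coef_poly ltn_ord iter_slot_shift_Phi ?subSS; last first.
  by rewrite -ltnS.
by congr (h _ *: _); apply: val_inj; rewrite /= inordK ?subSS// ltnS leq_subr.
Qed.

End States.

(** * The chain of equivalences *)

Theorem mainTheorem2 (R : realType) (m N : nat) (c : 'I_N.+1 -> R[i])
    (m_ge2 : (2 <= m)%N) (cN_neq0 : c ord_max != 0) :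
  let h := fun n : 'I_N.+1 => c n * sqrtC (n`!%:R / m%:R ^+ n) in
  let Psi : modes R m := \sum_(n < N.+1) c n *: Psi_state R m n in
  let Phi : modes R m := \sum_(n < N.+1) h n *: Phi_state R m n in
  slocc_equiv Phi (Phi_state R m N) /\
  [/\ slocc_equiv Psi Phi,
      slocc_equiv Phi (Phi_state R m N) &
      slocc_equiv (Phi_state R m N) (Psi_state R m N)].
Proof.
move=> h Psi Phi.
pose i0 : 'I_m := Ordinal (ltnW m_ge2).
have m_neq0 : m%:R != 0 :> R[i] by rewrite pnatr_eq0 -lt0n ltnW.
have sm_neq0 n : sqrtC m%:R ^+ n != 0 :> R[i] by rewrite expf_neq0// sqrtC_eq0.
have fact_neq0 n : sqrtC n`!%:R != 0 :> R[i].
  by rewrite sqrtC_eq0 pnatr_eq0 -lt0n fact_gt0.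
have hE (n : 'I_N.+1) : h n = c n * (sqrtC n`!%:R / sqrtC m%:R ^+ n).
  by rewrite /h rootCMl// rootCV ?exprn_ge0// rootCX.
have Phi_PhiN : slocc_equiv Phi (Phi_state R m N).
  rewrite /Phi (sum_Phi_state_slot_shift i0); apply: slocc_poly_slot_shift_sym.
  rewrite coef_poly/= subn0 (_ : inord N = ord_max); last first.
    by apply: val_inj; rewrite /= inordK.
  by rewrite hE !mulf_neq0// invr_neq0.
(* On tuples of sum at most [N] the freezing of the weights beyond [N] is not felt. *)
have minn_part (n : nat) (p : {ffun 'I_m -> nat}) k :
    (n <= N)%N -> (\sum_k p k = n)%N -> minn (p k) N = p k.
  move=> nN pn; apply/minn_idPl; apply: leq_trans nN.
  by rewrite -pn (bigD1 k)//= leq_addr.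
split=> //; split=> //.
(* The scalar of each [Psi_state] is exactly the ratio of [h n] to [c n], so one family of weights
   serves all [n] at once. *)
- apply: (@slocc_diag _ _ N (fun _ j => sqrtC j`!%:R)) => // p.
  rewrite !modes_sumE mulr_sumr; apply: eq_bigr => n _.
  have -> : (h n *: Phi_state R m n) p = h n * Phi_state R m n p by [].
  have -> : (c n *: Psi_state R m n) p = c n * Psi_state R m n p by [].
  rewrite Phi_stateE Psi_stateE hE; case: eqP => [pn|_]; last first.
    by rewrite !(mulr0, mul0r).
  have minnE k : minn (p k) N = p k by apply: minn_part pn; rewrite -ltnS.
  under eq_bigr do rewrite minnE.
  have prod_neq0 : \prod_k sqrtC (p k)`!%:R != 0 :> R[i].
    by apply/prodf_neq0 => k _; exact: fact_neq0.
  by field; rewrite prod_neq0 sm_neq0.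
- pose a : R[i] := sqrtC N`!%:R / sqrtC m%:R ^+ N.
  have a_neq0 : a != 0 by rewrite mulf_neq0// invr_neq0.
  (* The scalar [a] is put into the single mode [i0], so that it enters the product once. *)
  apply: (@slocc_diag _ _ N
    (fun k j => (if k == i0 then a else 1) / sqrtC j`!%:R)) => [k j|p].
    by rewrite mulf_neq0 ?invr_neq0//; case: ifP => // _; exact: oner_neq0.
  rewrite Phi_stateE Psi_stateE; case: eqP => [pN|_]; last first.
    by rewrite mul0r mulr0.
  under [in RHS]eq_bigr do rewrite (minn_part N)//.
  rewrite big_split/= -big_mkcond/= big_pred1_eq prodfV.
  by rewrite mul1r mulr1.
Qed.
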